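(* Let the source data $(X_S,Y_S)$, kernel $k$, kernel matrix $K_S=k(X_S,X_S)$, $\sigma_S>0$, source model $f_S(\cdot)^T=k(\cdot,X_S)[K_S+\sigma_S I]^{-1}Y_S$, input transformation $a:\mathbb{R}^{d_T}\to\mathbb{R}^{d_S}$, and target feature matrix $X_T$ be as in the context, and let $\Theta_T^B(x,x')=f_S(a(x))^Tf_S(a(x'))$ be the kernel induced by the trainable linear output mapping. Then for every $i\in\{1,\dots,N_T\}$, $$\lambda_i\big(\Theta_T^B(X_T,X_T)\big)\le\lambda_{\max}\big[k(a(X_T),X_S)\,k(X_S,a(X_T))\big]\cdot\lambda_{\max}\big[[K_S+\sigma_S I]^{-2}\big]\cdot\lambda_{\max}[Y_SY_S^T]$$ and $$\lambda_i\big(\Theta_T^B(X_T,X_T)\big)\ge\lambda_{\min}\big[k(a(X_T),X_S)\,k(X_S,a(X_T))\big]\cdot\lambda_{\min}\big[[K_S+\sigma_S I]^{-2}\big]\cdot\lambda_{\min}[Y_SY_S^T].$$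
   Context: Source data: $X_S=[x_s^1,\dots,x_s^{N_S}]^T\in\mathbb{R}^{N_S\times d_S}$, $Y_S=[y_s^1,\dots,y_s^{N_S}]^T\in\mathbb{R}^{N_S\times c_S}$. Target features: $x_1,\dots,x_{N_T}\in\mathbb{R}^{d_T}$, the rows of $X_T\in\mathbb{R}^{N_T\times d_T}$. The kernel $k:\mathbb{R}^{d_S}\times\mathbb{R}^{d_S}\to\mathbb{R}$ is symmetric and positive semi-definite, $k(x,x')=\langle\Phi(x),\Phi(x')\rangle$ for a feature map $\Phi$ (it is induced by the neural tangent kernel of the source network). For finite sequences of points $U=(u_i)$, $V=(v_j)$, $k(U,V)$ is the matrix with entries $k(u_i,v_j)$; $a(X_T)$ is the sequence $a(x_1),\dots,a(x_{N_T})$. Thus $K_S=k(X_S,X_S)$ is $N_S\times N_S$ and $k(a(X_T),X_S)=k(X_S,a(X_T))^T$ is $N_T\times N_S$. The source model $f_S:\mathbb{R}^{d_S}\to\mathbb{R}^{c_S}$ is $f_S(x)^T=k(x,X_S)[K_S+\sigma_S I]^{-1}Y_S$, $\sigma_S>0$. The target model is $f_T(x)=b\,f_S(a(x))$, where the output mapping $b$ is an arbitrary $c_T\times c_S$ matrix with all entries trainable; its neural tangent kernel with respect to the entries of $b$ is $\hat\Theta_T^B(x,x')=[f_S(a(x))^Tf_S(a(x'))]\otimes I_{c_T}$, and $\Theta_T^B(x,x')=f_S(a(x))^Tf_S(a(x'))$ is the corresponding scalar kernel. $\Theta_T^B(X_T,X_T)$ is the $N_T\times N_T$ matrix with entries $\Theta_T^B(x_i,x_j)$.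 For a symmetric matrix, $\lambda_i$ is the $i$-th largest eigenvalue, and $\lambda_{\max},\lambda_{\min}$ are the largest and smallest eigenvalues. *)

(* Defs.v *)
From HB Require Import structures.
From mathcomp Require Import all_boot all_order all_algebra.
From mathcomp Require Import polyrcf.
From mathcomp Require Import reals.
Set Implicit Arguments.
Unset Strict Implicit.
Unset Printing Implicit Defensive.
Import Order.TTheory GRing.Theory Num.Theory.
Local Open Scope ring_scope.

Section Eigenvalues.
Context {R : rcfType} {n : nat}.
Implicit Types (A : 'M[R]_n) (i : nat).

(* The real eigenvalues of A in decreasing order, each repeated according to
   its multiplicity as a root of the characteristic polynomial; rootsR lists
   the distinct real roots in increasing order.  When A is symmetric the
   characteristic polynomial splits, so that this list has size n. *)
Definition spectrum A : seq R :=
  rev (flatten [seq nseq (mup x (char_poly A)) x | x <- rootsR (char_poly A)]).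

(* Counted from 1: lambda A 1 is the largest eigenvalue.  The default value 0,
   here and in the next two definitions, is not reached when A is symmetric,
   0 < n and 1 <= i <= n; it is the value of lambda_max and lambda_min on the
   empty matrix. *)
Definition lambda A i : R := nth 0 (spectrum A) i.-1.
Definition lambda_max A : R := head 0 (spectrum A).
Definition lambda_min A : R := last 0 (spectrum A).

End Eigenvalues.

Section Kernels.
Context {R : realType}.

(* A finite sequence of points of R^d is a function from 'I_n to column
   vectors; points X reads off the data points stored as the rows of X. *)
Definition points {n d} (X : 'M[R]_(n, d)) : 'I_n -> 'cV[R]_d :=
  fun i => (row i X)^T.

Definition kernel_mx {d m n} (k : 'cV[R]_d -> 'cV[R]_d -> R)
    (U : 'I_m -> 'cV[R]_d) (V : 'I_n -> 'cV[R]_d) : 'M[R]_(m, n) :=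
  \matrix_(i, j) k (U i) (V j).

Definition symmetric_kernel {d} (k : 'cV[R]_d -> 'cV[R]_d -> R) : Prop :=
  forall x x', k x x' = k x' x.

Definition psd_kernel {d} (k : 'cV[R]_d -> 'cV[R]_d -> R) : Prop :=
  forall (n : nat) (u : 'I_n -> 'cV[R]_d) (w : 'I_n -> R),
    0 <= \sum_(i < n) \sum_(j < n) w i * w j * k (u i) (u j).

Definition source_gram {dS NS} (k : 'cV[R]_dS -> 'cV[R]_dS -> R)
    (XS : 'M[R]_(NS, dS)) : 'M[R]_NS :=
  kernel_mx k (points XS) (points XS).

(* Kernel ridge regression.  A single point x is the constant sequence of
   length 1, so that k(x, X_S) is a row vector of size NS. *)
Definition source_model {dS cS NS} (k : 'cV[R]_dS -> 'cV[R]_dS -> R)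
    (XS : 'M[R]_(NS, dS)) (YS : 'M[R]_(NS, cS)) (sigmaS : R)
    (x : 'cV[R]_dS) : 'cV[R]_cS :=
  (kernel_mx k (fun _ : 'I_1 => x) (points XS)
     *m invmx (source_gram k XS + sigmaS%:M) *m YS)^T.

(* Scalar factor of the neural tangent kernel of x |-> b *m f (a x) with
   respect to the entries of the matrix b, which is this scalar times the
   identity. *)
Definition output_ntk {dS dT cS} (f : 'cV[R]_dS -> 'cV[R]_cS)
    (a : 'cV[R]_dT -> 'cV[R]_dS) (x x' : 'cV[R]_dT) : R :=
  ((f (a x))^T *m f (a x')) 0 0.

End Kernels.

(* Main.v *)
(** Writing A = k(a(X_T), X_S) and N = (K_S + sigma_S I)^-1, the kernel matrix
    is B B^T with B = A N Y_S.  If v is an eigenvector for lambda_i, then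
    lambda_i |v|^2 = (v A N) Y_S Y_S^T (v A N)^T, and three applications of the
    Rayleigh bounds, to Y_S Y_S^T at v A N, to N^2 at v A and to A A^T at v,
    give both inequalities.  The Rayleigh bounds come from diagonalising a real
    symmetric matrix over R[i]. *)
Require Import Defs.
From mathcomp Require Import all_boot all_order all_algebra.
From mathcomp Require Import sesquilinear spectral polyrcf complex.
From mathcomp Require Import reals.
Set Implicit Arguments.
Unset Strict Implicit.
Unset Printing Implicit Defensive.
Import Order.TTheory GRing.Theory Num.Theory.
Local Open Scope ring_scope.

Local Notation sqnorm v := ((v *m v^T) 0 0).
Local Notation qform S v := ((v *m S *m v^T) 0 0).
Local Notation toC := (real_complex _).

(** The scalar part of the characteristic matrix commutes with P, so that matrix is itself
    conjugated by P, and the determinants of P and its inverse cancel. *)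
Lemma char_poly_conj (F : fieldType) (n : nat) (P A : 'M[F]_n) :
  P \in unitmx -> char_poly (invmx P *m A *m P) = char_poly A.
Proof.
move=> Pu; rewrite /char_poly.
have -> : char_poly_mx (invmx P *m A *m P)
    = map_mx polyC (invmx P) *m char_poly_mx A *m map_mx polyC P.
  rewrite /char_poly_mx mulmxBr mulmxBl -!map_mxM /= scalar_mxC.
  rewrite -[_%:M *m _ *m _]mulmxA.
  by rewrite -map_mxM mulVmx // map_mx1 mulmx1.
rewrite !det_mulmx mulrAC -det_mulmx -map_mxM mulVmx // map_mx1 det1.
by rewrite mul1r.
Qed.

(* The weights are w i = |(v P^-1)_i|^2, where P is a unitary matrix
   diagonalising S over R[i]. *)
Lemma symmetric_spectral_decomposition (R : rcfType) (n : nat) (S : 'M[R]_n) :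
  S^T = S ->
  exists d : 'I_n -> R,
    char_poly S = \prod_(x <- codom d) ('X - x%:P) /\
    forall v : 'rV[R]_n, exists2 w : 'I_n -> R, forall i, 0 <= w i &
      sqnorm v = \sum_i w i /\ qform S v = \sum_i d i * w i.
Proof.
move=> Ssym; pose SC := map_mx toC S; pose P := spectralmx SC.
have SCreal : SC \is a mxOver Num.real.
  by apply/mxOverP => i j; rewrite mxE; apply/complex_realP; exists (S i j).
have SCherm : SC \is hermsymmx.
  (* A real symmetric matrix is Hermitian; symmetry is expressed here as hermitianity for sign +1
     and the identity in place of conjugation. *)
  apply: realsym_hermsym SCreal.
  apply/is_hermitianmxP; rewrite expr0 scale1r map_mx_id //.
  by rewrite /SC map_trmx Ssym.
have Pu : P \in unitmx by exact: spectral_unit.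
have PV : invmx P = map_mx Num.conj P^T.
  exact/invmx_unitary/spectral_unitarymx.
(* Eigenvalues of a Hermitian matrix are real, so taking real parts loses nothing. *)
pose d i := complex.Re (spectral_diag SC 0 i).
have dE : spectral_diag SC = \row_i toC (d i).
  apply/rowP => i; rewrite mxE; apply/esym/RRe_real.
  exact: mxOverP (hermitian_spectral_diag_real SCherm) 0 i.
have SCE : SC = invmx P *m diag_mx (\row_i toC (d i)) *m P.
  by rewrite -dE; exact/orthomx_spectralP/hermitian_normalmx.
exists d; split.
  (* The embedding into R[i] is injective on polynomials, so the factorisation may be checked there,
     where [SC] is similar to a diagonal matrix. *)
  apply: (map_poly_inj toC); rewrite map_char_poly -/SC SCE char_poly_conj //.
  rewrite char_poly_trig ?diag_mx_is_trig // codomE big_map rmorph_prod /=.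
  rewrite big_enum /=; apply: eq_bigr => i _.
  by rewrite !mxE eqxx mulr1n rmorphB /= map_polyX map_polyC.
move=> v; pose y : 'rV[R[i]]_n := map_mx toC v *m invmx P.
(* As P is unitary and v is real, [P *m v^T] is the conjugate transpose of y; both forms thus become
   sums over the products of [y 0 i] with its conjugate. *)
have yE : P *m (map_mx toC v)^T = map_mx Num.conj y^T.
  rewrite trmx_mul map_mxM; congr (_ *m _); apply/matrixP => i j.
    by rewrite PV !mxE; exact/esym/conjCK.
  by rewrite !mxE; apply/esym/CrealP/complex_realP; exists (v j i).
pose w i := complex.Re (y 0 i * (y 0 i)^*).
have wE i : toC (w i) = y 0 i * (y 0 i)^*.
  by apply/RRe_real/ger0_real; rewrite mul_conjC_ge0.
exists w; first by move=> i; rewrite -ler0c [X in 0 <= X]wE mul_conjC_ge0.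
have toCE (A : 'M[R]_1) : toC (A 0 0) = map_mx toC A 0 0 by rewrite mxE.
split; apply: complexI; rewrite toCE rmorph_sum !map_mxM -map_trmx.
- rewrite -{1}[map_mx toC v](mulmxKV Pu) -/y -mulmxA yE mxE.
  by apply: eq_bigr => i _; rewrite /= wE !mxE.
- rewrite -/SC SCE !mulmxA -/y -mulmxA yE mul_mx_diag mxE.
  by apply: eq_bigr => i _; rewrite rmorphM /= wE !mxE mulrCA mulrA.
Qed.

Lemma mup_prod_XsubC (F : fieldType) (x : F) (s : seq F) :
  mup x (\prod_(y <- s) ('X - y%:P)) = count_mem x s.
Proof.
elim: s => [|y s IHs]; first by rewrite big_nil mupNroot // root1.
rewrite big_cons mupM ?polyXsubC_eq0 //; last first.
  exact/monic_neq0/monic_prod_XsubC.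
by rewrite IHs /= -['X - _]expr1 mup_XsubCX; case: eqP.
Qed.

Lemma count_flatten_nseq (T : eqType) (m : T -> nat) (s : seq T) (x : T) :
  uniq s ->
  count_mem x (flatten [seq nseq (m y) y | y <- s]) = ((x \in s) * m x)%N.
Proof.
elim: s => //= y s IHs /andP[yNs /IHs E].
rewrite count_cat count_nseq E in_cons eq_sym /=.
by case: eqP yNs => [->|_] //= /negPf->; rewrite addn0.
Qed.

Lemma sorted_flatten_nseq (d : Order.disp_t) (T : porderType d)
    (m : T -> nat) (s : seq T) :
  sorted <%O s -> sorted <=%O (flatten [seq nseq (m y) y | y <- s]).
Proof.
rewrite (sorted_pairwise lt_trans) (sorted_pairwise le_trans).
elim: s => //= y s IHs /andP[/allP y_lt /IHs ps].
rewrite pairwise_cat ps andbT; apply/andP; split.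
  apply/allrelP => u v /nseqP[-> _] /flattenP[_ /mapP[z zs ->]] /nseqP[-> _].
  exact/ltW/y_lt.
by elim: (m y) => //= j ->; rewrite all_nseq lexx orbT.
Qed.

Section SymmetricSpectrum.
Variables (R : rcfType) (n : nat).
Implicit Types (S : 'M[R]_n) (v : 'rV[R]_n).

(** Counts are compared value by value: both lists contain x exactly [mup x (char_poly S)] times,
    which is 0 when x is not a root. *)
Lemma perm_spectrum S (s : seq R) :
  char_poly S = \prod_(x <- s) ('X - x%:P) -> perm_eq (spectrum S) s.
Proof.
move=> chS; have ch0 : char_poly S != 0 by exact/monic_neq0/char_poly_monic.
rewrite perm_rev; apply/allP => x _ /=.
rewrite count_flatten_nseq; last first.
  exact: (sorted_uniq lt_trans ltxx (sorted_roots _ _ _)).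
rewrite -(roots_on_rootsR ch0) /= -mup_prod_XsubC -chS.
case: (boolP (root _ _)) => [_|/mupNroot->] //; by rewrite mul1n.
Qed.

Lemma spectrum_sorted S : sorted >=%O (spectrum S).
Proof. by rewrite rev_sorted sorted_flatten_nseq // sorted_roots. Qed.

(** Membership of x rules out the empty spectrum, so the default value of [head] never occurs. *)
Lemma le_lambda_max S x : x \in spectrum S -> x <= lambda_max S.
Proof.
have := spectrum_sorted S; rewrite /lambda_max.
case: (spectrum S) => //= y s /(order_path_min ge_trans) /allP y_ge.
by rewrite in_cons => /orP[/eqP->|/y_ge].
Qed.

Lemma lambda_min_le S x : x \in spectrum S -> lambda_min S <= x.
Proof.
have := spectrum_sorted S; rewrite /lambda_min.
case/lastP: (spectrum S) => // s y.
rewrite -rev_sorted rev_rcons /= => /(order_path_min le_trans)/allP y_le.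
rewrite last_rcons mem_rcons in_cons => /orP[/eqP->|xs] //.
by apply/y_le; rewrite mem_rev.
Qed.

Lemma sqnorm_ge0 v : 0 <= sqnorm v.
Proof. by rewrite mxE sumr_ge0 // => i _; rewrite !mxE -expr2 sqr_ge0. Qed.

Lemma sqnorm_gt0 v : v != 0 -> 0 < sqnorm v.
Proof.
move=> v_neq0; rewrite lt_neqAle sqnorm_ge0 andbT eq_sym.
apply: contra_neq v_neq0 => v0.
apply/rowP => i; move: v0; rewrite mxE => /eqP.
rewrite psumr_eq0 => [|j _]; last first.
  by rewrite !mxE -expr2 sqr_ge0.
by move=> /allP/(_ i (mem_index_enum _)); rewrite !mxE mulf_eq0 orbb => /eqP.
Qed.

Lemma spectrum_eigenvector S x :
  x \in spectrum S ->
  exists2 v : 'rV[R]_n, 0 < sqnorm v & qform S v = x * sqnorm v.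
Proof.
rewrite mem_rev => /flattenP[_ /mapP[y yroot ->]] /nseqP[-> _].
have ch0 : char_poly S != 0 by exact/monic_neq0/char_poly_monic.
move: yroot; rewrite -(roots_on_rootsR ch0) /= -eigenvalue_root_char.
case/eigenvalueP => v vS /sqnorm_gt0 v0; exists v => //.
by rewrite vS -scalemxAl mxE.
Qed.

Lemma size_spectrum S : S^T = S -> size (spectrum S) = n.
Proof.
case/symmetric_spectral_decomposition => d [/perm_spectrum/perm_size -> _].
by rewrite size_codom card_ord.
Qed.

Lemma mem_lambda S i : S^T = S -> (1 <= i <= n)%N -> lambda S i \in spectrum S.
Proof.
by move=> /size_spectrum sS; case: i => // i i_lt; rewrite mem_nth ?sS.
Qed.

(** Both forms are sums over the same nonnegative weights, so the eigenvalues [d i] are compared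
    termwise with the extreme ones. *)
Lemma rayleigh_bounds S v : S^T = S ->
  lambda_min S * sqnorm v <= qform S v <= lambda_max S * sqnorm v.
Proof.
case/symmetric_spectral_decomposition => d [/perm_spectrum/perm_mem dS].
case/(_ v) => w w0 [-> ->]; rewrite !mulr_sumr.
by apply/andP; split; apply: ler_sum => i _; apply: ler_wpM2r => //;
  [apply: lambda_min_le | apply: le_lambda_max]; rewrite dS codom_f.
Qed.

(** For an eigenvector v, x times the positive [sqnorm v] equals the squared norm of [v *m B]. *)
Lemma spectrum_gram_ge0 p (B : 'M[R]_(n, p)) x :
  x \in spectrum (B *m B^T) -> 0 <= x.
Proof.
case/spectrum_eigenvector => v v0 E; rewrite -(pmulr_lge0 _ v0) -E.
rewrite mulmxA -mulmxA -trmx_mul mxE sumr_ge0 // => i _.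
by rewrite !mxE -expr2 sqr_ge0.
Qed.

(** This covers the empty matrix too, where the default value is 0. *)
Lemma lambda_max_gram_ge0 p (B : 'M[R]_(n, p)) : 0 <= lambda_max (B *m B^T).
Proof.
have := @spectrum_gram_ge0 p B; rewrite /lambda_max.
by case: spectrum => //= x s; apply; rewrite mem_head.
Qed.

Lemma lambda_min_gram_ge0 p (B : 'M[R]_(n, p)) : 0 <= lambda_min (B *m B^T).
Proof.
have := @spectrum_gram_ge0 p B; rewrite /lambda_min.
by case: spectrum => //= x s; apply; rewrite mem_last.
Qed.

End SymmetricSpectrum.

Lemma tr_gram (R : comNzRingType) (n p : nat) (B : 'M[R]_(n, p)) :
  (B *m B^T)^T = B *m B^T.
Proof. by rewrite trmx_mul trmxK. Qed.

Lemma lambda_gram_mulmx3_bounds (R : rcfType) (m n p : nat)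
    (A : 'M[R]_(m, n)) (N : 'M[R]_n) (Y : 'M[R]_(n, p)) (B : 'M[R]_(m, p))
    (i : nat) :
  B = A *m N *m Y -> N^T = N -> (1 <= i <= m)%N ->
  lambda_min (A *m A^T) * lambda_min (N ^+ 2) * lambda_min (Y *m Y^T)
    <= lambda (B *m B^T) i
    <= lambda_max (A *m A^T) * lambda_max (N ^+ 2) * lambda_max (Y *m Y^T).
Proof.
move=> BE Nsym i_bnd.
(* Symmetry of N makes its square a Gram matrix, so that the Gram lemmas apply to all three
   factors. *)
have N2E : N ^+ 2 = N *m N^T by rewrite Nsym expr2.
have [v v0 E] := spectrum_eigenvector (mem_lambda (tr_gram B) i_bnd).
have E1 : lambda (B *m B^T) i * sqnorm v = qform (Y *m Y^T) (v *m A *m N).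
  by rewrite -E BE !trmx_mul !mulmxA.
have E2 : sqnorm (v *m A *m N) = qform (N ^+ 2) (v *m A).
  by rewrite N2E !trmx_mul !mulmxA.
have E3 : sqnorm (v *m A) = qform (A *m A^T) v by rewrite !trmx_mul !mulmxA.
have /andP[lY uY] := rayleigh_bounds (v *m A *m N) (tr_gram Y).
have /andP[lN uN] := rayleigh_bounds (v *m A) (tr_gram N).
have /andP[lA uA] := rayleigh_bounds v (tr_gram A).
rewrite -N2E -E2 in lN uN; rewrite -E3 in lA uA; rewrite -E1 in lY uY.
have [maxY0 minY0] := (lambda_max_gram_ge0 Y, lambda_min_gram_ge0 Y).
have [maxN0 minN0] := (lambda_max_gram_ge0 N, lambda_min_gram_ge0 N).
rewrite -N2E in maxN0 minN0.
(* After multiplication by [sqnorm v], the bounds for Y, N and A are applied in turn; nonnegativity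
   of the extreme eigenvalues of the first two keeps the direction of the inequalities. *)
rewrite -(ler_pM2r v0) -[X in _ && X](ler_pM2r v0); apply/andP; split.
  apply: le_trans lY; rewrite mulrAC mulrC ler_wpM2l //.
  by apply: le_trans lN; rewrite mulrAC mulrC ler_wpM2l.
apply: le_trans uY _; rewrite [leRHS]mulrAC [leRHS]mulrC ler_wpM2l //.
by apply: le_trans uN _; rewrite [leRHS]mulrAC [leRHS]mulrC ler_wpM2l.
Qed.

Theorem theorem3 (R : realType) (dS cS dT NS NT : nat)
    (XS : 'M[R]_(NS, dS)) (YS : 'M[R]_(NS, cS)) (XT : 'M[R]_(NT, dT))
    (k : 'cV[R]_dS -> 'cV[R]_dS -> R) (a : 'cV[R]_dT -> 'cV[R]_dS)
    (sigmaS : R)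
    (k_sym : symmetric_kernel k) (k_psd : psd_kernel k)
    (sigmaS_gt0 : 0 < sigmaS) :
  let fS := source_model k XS YS sigmaS in
  let aXT := a \o points XT in
  let ThetaB := kernel_mx (output_ntk fS a) (points XT) (points XT) in
  let G := kernel_mx k aXT (points XS) *m kernel_mx k (points XS) aXT in
  let M := source_gram k XS + sigmaS%:M in
  forall i : nat, (1 <= i <= NT)%N ->
    lambda ThetaB i
      <= lambda_max G * lambda_max (invmx M ^+ 2) * lambda_max (YS *m YS^T)
    /\
    lambda_min G * lambda_min (invmx M ^+ 2) * lambda_min (YS *m YS^T)
      <= lambda ThetaB i.
Proof.
move=> fS aXT ThetaB G M i i_bnd.
pose A := kernel_mx k aXT (points XS).
(* Symmetry of k makes the second factor of G the transpose of the first. *)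
have GE : G = A *m A^T.
  by congr (_ *m _); apply/matrixP => r s; rewrite !mxE k_sym.
have Nsym : (invmx M)^T = invmx M.
  rewrite trmx_inv linearD /= tr_scalar_mx; congr (invmx (_ + _)).
  by apply/matrixP => r s; rewrite !mxE k_sym.
pose B := A *m invmx M *m YS.
(* The predictions at the transformed target points are the rows of B, so their inner products are
   the entries of [B *m B^T]. *)
have rowB r : (fS (a (points XT r)))^T = row r B.
  rewrite trmxK /B !row_mul; congr (_ *m _ *m _).
  by apply/rowP => s; rewrite !mxE.
have -> : ThetaB = B *m B^T.
  apply/matrixP => r s; rewrite mxE /output_ntk -[fS (a (points XT s))]trmxK.
  rewrite !rowB !mxE; apply: eq_bigr => q _.
  by rewrite !mxE.
have /andP[lo up] := lambda_gram_mulmx3_bounds (erefl B) Nsym i_bnd.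
by rewrite GE.
Qed.
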